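(* Let $\mathcal{L}$ be a nonempty class (set) of $d$-dimensional closed convex sets in $\mathbb{R}^d$ such that for every $L\in\mathcal{L}$ the set $\operatorname{rec}(L)$ is a linear space, and let $M:=\mathbb{R}^d\setminus\bigcup_{L\in\mathcal{L}}\operatorname{int}(L)$. Let $K$ be a bounded (line-free) closed convex set in $\mathbb{R}^d$. Then $R_{\mathcal{L}}^i(K)$ converges to $\operatorname{conv}(K\cap M)$ in the Hausdorff distance, as $i\to+\infty$.
   Context: Here $d\in\mathbb{N}=\{1,2,\ldots\}$. For a closed convex set $K\subseteq\mathbb{R}^d$ and a $d$-dimensional closed convex set $L$, $R_L(K):=\operatorname{conv}(K\setminus\operatorname{int}(L))$; $R_{\mathcal{L}}(K):=\bigcap_{L\in\mathcal{L}}R_L(K)$; $R_{\mathcal{L}}^0(K):=K$ and $R_{\mathcal{L}}^i(K):=R_{\mathcal{L}}(R_{\mathcal{L}}^{i-1}(K))$ for $i\in\mathbb{N}$. A closed convex set is line-free if it contains no line. The recession cone of a nonempty closed convex set $L$ is $\operatorname{rec}(L)=\{y\in\mathbb{R}^d : x+ty\in L\ \forall x\in L\ \forall t\ge0\}$. The Hausdorff distance of closed convex sets $K_1,K_2$ is $\delta(K_1,K_2)=\min\{\rho\ge0: K_1\subseteq K_2+B(o,\rho)\text{ and }K_2\subseteq K_1+B(o,\rho)\}$, where $B(o,\rho)$ is the closed Euclidean ball of radius $\rho$ centered at the origin; in particular $\delta(\emptyset,\emptyset)=0$ and $\delta(K_1,K_2)=+\infty$ if exactly one of $K_1,K_2$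 is empty. *)

(* Defs.v *)
From HB Require Import structures.
From mathcomp Require Import all_boot all_order all_algebra.
From mathcomp Require Import all_classical all_reals all_analysis.

Set Implicit Arguments.
Unset Strict Implicit.
Unset Printing Implicit Defensive.

Import Order.TTheory GRing.Theory Num.Theory.
Import numFieldNormedType.Exports.

Local Open Scope classical_set_scope.
Local Open Scope ring_scope.

Section Defs.
Variables (R : realType) (d : nat).
Local Notation E := 'rV[R]_d.
Implicit Types (A K L : set E) (LL : set (set E)).

Definition convex_hull A : set E := smallest (@convex_set R E) A.

Definition affine_set A :=
  forall (x y : E) (t : R), A x -> A y -> A ((1 - t) *: x + t *: y).

Definition affine_hull A : set E := smallest affine_set A.

(* The affine hull of A is a translate of a k-dimensional linear subspace;
   in particular A is nonempty. *)
Definition has_affine_dim A (k : nat) :=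
  exists (x : E) (U : {vspace E}),
    affine_hull A = [set x + u | u in [set` U]] /\ \dim U = k.

Definition recession_cone L : set E :=
  [set y | forall (x : E) (t : R), L x -> 0 <= t -> L (x + t *: y)].

Definition is_linear_space A := exists U : {vspace E}, A = [set` U].

(* R_L(K) *)
Definition Rone L K : set E := convex_hull (K `\` interior L).

(* R_LL(K); its i-th iterate is [iter i (Rclass LL) K]. *)
Definition Rclass LL K : set E := \bigcap_(L in LL) Rone L K.

(* The library norm on row vectors is the max-norm (it induces the same
   topology), so the Euclidean norm is defined here. *)
Definition euclidean_norm (x : E) : R := Num.sqrt (\sum_i x ord0 i ^+ 2).

Definition euclidean_ball (rho : R) : set E := [set x | euclidean_norm x <= rho].

Definition minkowski_sum A1 A2 : set E := [set x + y | x in A1 & y in A2].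

(* On closed sets the infimum is attained when it is finite.  The infimum of
   the empty set is +oo, which covers the case of exactly one empty argument. *)
Definition hausdorff_distance K1 K2 : \bar R :=
  ereal_inf [set rho%:E | rho in [set rho : R | [/\ 0 <= rho,
    K1 `<=` minkowski_sum K2 (euclidean_ball rho) &
    K2 `<=` minkowski_sum K1 (euclidean_ball rho)]]].

End Defs.

(* Main.v *)
Require Import Defs.
From HB Require Import structures.
From mathcomp Require Import all_boot all_order all_algebra.
From mathcomp Require Import all_classical all_reals all_analysis.
From mathcomp Require Import ring lra.

Import Order.TTheory GRing.Theory Num.Theory.
Import numFieldNormedType.Exports.

Local Open Scope classical_set_scope.
Local Open Scope ring_scope.

(** Write K_i for the i-th iterate of K.  The K_i form a decreasing sequence of
compact convex sets; let K_oo be their intersection, and let C be the convex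
hull of K `&` M, where M is the complement of all the interiors of the sets L.

A point of K `&` M is never removed: it lies outside int L for every L, hence
in every K_i.  So C is included in every K_i, and by compactness it remains to
show that K_oo is included in C; then any neighbourhood of C contains K_i for
all large i.

The link between K_oo and the operator is that convex hulls commute with
decreasing intersections of compact sets ([bigcap_convex_hull]).  Since K_{i+1}
is included in the convex hull of K_i minus int L, every L satisfies
K_oo `<=` convex_hull (K_oo minus int L).  Consequently no point of int L is an
extreme point of K_oo.  The commutation, as well as the closedness of the
convex hull of a compact set ([convex_hull_closed]), comes from Caratheodory's
theorem ([caratheodory]): the number of points in the convex combinations being
bounded by d + 1, weights and points converge together along an ultrafilter
([convex_hull_cvg]).

Suppose now that x is in K_oo but not in C.  Some Euclidean ball contains C and
misses x ([ball_separation]); let c be its centre and z a point of K_oo at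
maximal distance from c.  Then z is farther from c than all of C, so z is not in
M and belongs to int L for some L.  But the points of K_oo minus int L are all
different from z and not farther from c than z, so by strict convexity of the
ball their convex hull misses z ([farthest_notin_convex_hull]): contradiction. *)

(** * Convex combinations and Caratheodory's theorem *)

Section Caratheodory.
Set Implicit Arguments.
Unset Strict Implicit.
Variables (R : realType) (d : nat).
Local Notation E := 'rV[R]_d.
Implicit Types A B C K L : set E.

(** Replaces the convexity operator on bundled scalars of [0, 1] by plain
scalars, on which ring reasoning is available. *)
Lemma convex_setE A : @convex_set R E A <->
  forall (x y : E) (t : R), 0 <= t <= 1 -> A x -> A y ->
    A (t *: x + (1 - t) *: y).
Proof.
split=> [cA x y t t01 /mem_set Ax /mem_set Ay|cA x y t /set_mem Ax /set_mem Ay].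
  have /andP[t0 t1] := t01.
  by have /set_mem := cA x y (@Itv01 _ t t0 t1) Ax Ay.
by apply/mem_set/cA => //; apply/andP; split.
Qed.

Definition convex_combination n A : set E :=
  [set x | exists (l : 'I_n -> R) (y : 'I_n -> E),
    [/\ forall i, 0 <= l i, \sum_i l i = 1, forall i, A (y i)
      & x = \sum_i l i *: y i]].

Lemma convex_combination_sub n A B :
  @convex_set R E B -> A `<=` B -> convex_combination n A `<=` B.
Proof.
move=> /convex_setE cB AB x [l [y [l0 l1 yA ->]]].
elim: n l y l0 l1 yA => [|n IHn] l y l0 l1 yA.
  by move: l1; rewrite big_ord0 => /eqP; rewrite eq_sym oner_eq0.
rewrite big_ord_recl; move: l1; rewrite big_ord_recl => l1.
have s0 : 0 <= \sum_(i < n) l (lift ord0 i) by exact: sumr_ge0.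
have [s_eq0|s_neq0] := eqVneq (\sum_(i < n) l (lift ord0 i)) 0.
  have lz i : l (lift ord0 i) = 0.
    by apply: (psumr_eq0P (P := xpredT) _ s_eq0) => // j _; exact: l0.
  rewrite big1 => [|i _]; last by rewrite lz scale0r.
  by move: l1; rewrite s_eq0 !addr0 => ->; rewrite scale1r; exact: AB.
(* Renormalise the tail by its total weight, which is 1 - l ord0. *)
rewrite -[X in _ + X](scalerKV s_neq0).
have -> : \sum_(i < n) l (lift ord0 i) = 1 - l ord0 by rewrite -l1; ring.
rewrite scaler_sumr; apply: cB; [|exact: AB|].
  by rewrite l0 -l1 lerDl.
under eq_bigr do rewrite scalerA.
apply: IHn => // [i|].
  by rewrite mulr_ge0// invr_ge0 -l1 addrC addKr.
have e : 1 - l ord0 = \sum_(i < n) l (lift ord0 i) by rewrite -l1; ring.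
by rewrite -mulr_sumr e mulVf.
Qed.

Lemma sub_convex_combination n A : A `<=` convex_combination n.+1 A.
Proof.
move=> x Ax; exists (fun i => if i == ord0 then 1 else 0), (fun=> x); split => //.
- by move=> i; case: ifP.
- by rewrite -big_mkcond big_pred1_eq.
- by rewrite -scaler_suml -big_mkcond big_pred1_eq scale1r.
Qed.

(** Appending a constant coordinate 1 to the points turns affine dependence into
linear dependence of n + 1 > d + 1 row vectors of length d + 1.  The
coefficients are not all zero and sum to zero, so one of them is positive. *)
Lemma affine_dependence n (y : 'I_n.+1 -> E) : (d < n)%N ->
  exists m : 'I_n.+1 -> R,
    [/\ exists j, 0 < m j, \sum_i m i = 0 & \sum_i m i *: y i = 0].
Proof.
move=> dn.
pose B : 'M[R]_(n.+1, d + 1) := row_mx (\matrix_(i, j) y i ord0 j) (const_mx 1).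
have : kermx B != 0.
  rewrite -mxrank_eq0 mxrank_ker subn_eq0 -ltnNge ltnS.
  by rewrite (leq_trans (rank_leq_col _)) // addn1.
move=> /rowV0Pn[v /sub_kermxP]; rewrite mul_mx_row -row_mx0.
move=> /eq_row_mx[vy v1] v0.
have s1 : \sum_i v ord0 i = 0.
  have /matrixP/(_ ord0 ord0) := v1; rewrite mxE [RHS]mxE => v1e.
  rewrite -[RHS]v1e.
  by apply: eq_bigr => i _; rewrite !mxE mulr1.
have sy : \sum_i v ord0 i *: y i = 0.
  apply/rowP => k; have /matrixP/(_ ord0 k) := vy; rewrite mxE [RHS]mxE => vk.
  rewrite summxE [RHS]mxE -[RHS]vk.
  by apply: eq_bigr => i _; rewrite !mxE.
exists (v ord0); split => //.
apply: contrapT => /forallNP nv; move/eqP: v0; apply; apply/rowP => i.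
rewrite mxE; apply/eqP; rewrite -oppr_eq0.
have np j : 0 <= - v ord0 j by rewrite oppr_ge0 leNgt; exact/negP.
have sN : \sum_(i < n.+1) - v ord0 i = 0 by rewrite sumrN s1 oppr0.
by apply/eqP; apply: (psumr_eq0P (P := xpredT) _ sN) => // j _; exact: np.
Qed.

(** Subtract from the weights l the multiple t * m of an affine dependence m
for which a first weight vanishes: the point and the total weight do not change,
and the point of index j can be dropped. *)
Lemma convex_combination_pred n A : (d < n)%N ->
  convex_combination n.+1 A `<=` convex_combination n A.
Proof.
move=> dn x [l [y [l0 l1 yA ->]]].
have [m [[j0 mj0] m0 my]] := affine_dependence y dn.
have [j mj tmin] := @Order.TotalTheory.arg_minP _ _ _ j0 (fun j => 0 < m j)
  (fun j => l j / m j) mj0.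
pose t := l j / m j; pose l' i := l i - t * m i.
have l'j : l' j = 0 by rewrite /l' /t divfK ?subrr// gt_eqF.
have t0 : 0 <= t by rewrite divr_ge0// ltW.
have l'0 i : 0 <= l' i.
  rewrite /l' subr_ge0; have [mi|mi] := ltP 0 (m i).
    by rewrite -ler_pdivlMr//; exact: tmin.
  by apply: le_trans (l0 i); rewrite mulr_ge0_le0.
have l'1 : \sum_i l' i = 1 by rewrite sumrB -mulr_sumr m0 mulr0 subr0.
have l'y : \sum_i l i *: y i = \sum_i l' i *: y i.
  under [RHS]eq_bigr do rewrite scalerBl -scalerA.
  by rewrite sumrB -scaler_sumr my scaler0 subr0.
exists (l' \o lift j), (y \o lift j); split => //=.
- by rewrite -l'1 (bigD1_ord j)//= l'j add0r.
- by rewrite l'y (bigD1_ord j)//= l'j scale0r add0r.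
Qed.

Lemma caratheodory n A :
  convex_combination (d.+1 + n) A `<=` convex_combination d.+1 A.
Proof.
elim: n => [|n IHn] x; first by rewrite addn0.
rewrite addnS => /convex_combination_pred Ax; apply: IHn; apply: Ax.
by rewrite ltnS leq_addr.
Qed.

(** A segment between two combinations of d + 1 points consists of combinations
of 2 (d + 1) points, which Caratheodory's theorem shortens. *)
Lemma convex_combination_convex A :
  @convex_set R E (convex_combination d.+1 A).
Proof.
apply/convex_setE => x y t /andP[t0 t1].
move=> [k [u [k0 k1 uA ->]]] [l [v [l0 l1 vA ->]]].
apply: (@caratheodory d.+1).
exists (fun i : 'I_(d.+1 + d.+1) => match fintype.split i with
    inl a => t * k a | inr b => (1 - t) * l b end),
  (fun i : 'I_(d.+1 + d.+1) => match fintype.split i with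
    inl a => u a | inr b => v b end).
have sl (i : 'I_d.+1) : fintype.split (lshift d.+1 i) = inl i.
  exact: (@unsplitK d.+1 d.+1 (inl i)).
have sr (i : 'I_d.+1) : fintype.split (rshift d.+1 i) = inr i.
  exact: (@unsplitK d.+1 d.+1 (inr i)).
split.
- by move=> i; case: fintype.split => j; rewrite mulr_ge0// subr_ge0.
- rewrite big_split_ord/=.
  under eq_bigr do rewrite sl.
  under [X in _ + X]eq_bigr do rewrite sr.
  by rewrite -!mulr_sumr k1 l1 !mulr1 addrC subrK.
- by move=> i; case: fintype.split.
- rewrite big_split_ord/=.
  under [in RHS]eq_bigr do rewrite sl -scalerA.
  under [X in _ = _ + X]eq_bigr do rewrite sr -scalerA.
  by rewrite -!scaler_sumr.
Qed.

Lemma convex_hullE A : convex_hull A = convex_combination d.+1 A.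
Proof.
apply/seteqP; split.
  apply: smallest_sub; first exact: convex_combination_convex.
  exact: sub_convex_combination.
move=> x Ax B [cB AB]; exact: convex_combination_sub cB AB _ Ax.
Qed.

Lemma convex_hull_convex A : @convex_set R E (convex_hull A).
Proof. by rewrite convex_hullE; exact: convex_combination_convex. Qed.

Lemma sub_convex_hull A : A `<=` convex_hull A.
Proof. exact: sub_smallest. Qed.

End Caratheodory.

(** * Convex hulls and limits of compact sets *)

Section Compactness.
Set Implicit Arguments.
Unset Strict Implicit.
Variables (R : realType) (d : nat).
Local Notation E := 'rV[R]_d.
Implicit Types A B C K L : set E.

Lemma compact_closed_rV A : compact A -> closed A.
Proof. by apply: compact_closed; exact: norm_hausdorff. Qed.

Lemma ultra_compact_cvg T (V : topologicalType) (U : set_system T) (g : T -> V)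
    (B : set V) : UltraFilter U -> compact B ->
  (\forall t \near U, B (g t)) -> exists2 p, B p & g t @[t --> U] --> p.
Proof.
move=> UU cB UB.
have [p [Bp gp]] : B `&` cluster (g t @[t --> U]) !=set0 by exact: cB.
exists p => // N Np.
have [//|Un] := in_ultra_setVsetC (g @^-1` N) UU.
by have [q []] := gp (~` N) N Un Np.
Qed.

(** Upper semicontinuity of convex hulls: a limit of points of the convex hulls
of the sets A t lies in the convex hull of what the sets A t accumulate on.
Write f t as a combination of d + 1 points; along an ultrafilter finer than F,
each weight and each point converges, by compactness of `[0, 1] and K, and the
limit of the combinations is the combination of the limits. *)
Lemma convex_hull_cvg T (F : set_system T) (FF : ProperFilter F)
    (A : T -> set E) (f : T -> E) K (x : E) :
  compact K -> (\forall t \near F, A t `<=` K) ->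
  (\forall t \near F, convex_hull (A t) (f t)) -> f t @[t --> F] --> x ->
  convex_hull
    (\bigcap_(C in [set C | closed C /\ \forall t \near F, A t `<=` C]) C) x.
Proof.
move=> cK AK Af fx.
have [U [UU FU]] := ultraFilterLemma FF.
have /choice[l /choice[y ly]] : forall t,
    exists (l : 'I_d.+1 -> R) (y : 'I_d.+1 -> E),
    convex_hull (A t) (f t) ->
    [/\ forall i, 0 <= l i, \sum_i l i = 1, forall i, A t (y i)
      & f t = \sum_i l i *: y i].
  move=> t; have [|nA] := pselect (convex_hull (A t) (f t)).
    by rewrite convex_hullE => -[l [y lyP]]; exists l, y.
  by exists (fun=> 0), (fun=> 0).
have {}Af : \forall t \near U, convex_hull (A t) (f t) by exact: FU.
have /choice[l0 l0P] i : exists p : R, 0 <= p /\ l t i @[t --> U] --> p.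
  have [|p p01 lp] := ultra_compact_cvg (g := l ^~ i) UU
    (@segment_compact R 0 1).
    apply: filterS Af => t /ly[l0 l1 _ _] /=; rewrite in_itv/= l0 -l1.
    by rewrite (bigD1 i)//= lerDl sumr_ge0.
  by exists p; split => //; move: p01; rewrite /= in_itv/= => /andP[].
have yC C i : (\forall t \near F, A t `<=` C) -> \forall t \near U, C (y t i).
  move=> AC; have {}AC : \forall t \near U, A t `<=` C by exact: FU.
  by apply: filterS2 Af AC => t /ly[_ _ yA _] AC; exact/AC/yA.
have /choice[y0 y0P] i : exists p : E, y t i @[t --> U] --> p.
  have [|p _ yp] := ultra_compact_cvg (g := y ^~ i) UU cK; first exact: yC.
  by exists p.
rewrite convex_hullE; exists l0, y0; split.
- by move=> i; have [] := l0P i.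
- have lim1 : \sum_i l t i @[t --> U] --> \sum_i l0 i.
    apply: cvg_big => [|i _]; first exact: add_continuous.
    by have [] := l0P i.
  have lim2 : \sum_i l t i @[t --> U] --> (1 : R).
    by apply: cvg_near_cst; apply: filterS Af => t /ly[].
  exact: (cvg_unique _ lim1 lim2).
- move=> i C [clC AC].
  exact: (@closed_cvg _ _ U _ (y ^~ i) C clC (yC C i AC) _ (y0P i)).
- have lim1 : \sum_i l t i *: y t i @[t --> U] --> \sum_i l0 i *: y0 i.
    apply: cvg_big => [|i _]; first exact: add_continuous.
    by apply: cvgZ; [have [] := l0P i|exact: y0P].
  have lim2 : f t @[t --> U] --> \sum_i l0 i *: y0 i.
    apply: cvg_trans lim1; apply: near_eq_cvg.
    by apply: filterS Af => t /ly[].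
  apply: (cvg_unique _ _ lim2); first exact: norm_hausdorff.
  by apply: cvg_trans fx => N; exact: FU.
Qed.

Lemma convex_hull_closed A : compact A -> closed (convex_hull A).
Proof.
move=> cA x Ax.
have clA : closed A by exact: compact_closed_rV.
pose F := within (convex_hull A) (nbhs x).
have FF : ProperFilter F by exact: within_nbhs_proper.
have : convex_hull
    (\bigcap_(C in [set C | closed C /\ \forall t \near F, A `<=` C]) C) x.
  apply: (@convex_hull_cvg _ F FF (fun=> A) id A) => //.
  - by near=> t.
  - by apply: withinT.
  - exact: cvg_within.
apply: sub_smallest2r; first exact: convex_hull_convex.
by move=> y; apply; split => //; near=> t.
Unshelve. all: by end_near. Qed.

(** [convex_hull_cvg] for a constant sequence of points. *)
Lemma bigcap_convex_hull (A : nat -> set E) :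
  compact (A 0%N) -> (forall n, closed (A n)) ->
  (forall m n, (m <= n)%N -> A n `<=` A m) ->
  \bigcap_n convex_hull (A n) `<=` convex_hull (\bigcap_n A n).
Proof.
move=> cA clA decr x Ax.
have : convex_hull
    (\bigcap_(C in [set C | closed C /\ \forall n \near \oo, A n `<=` C]) C) x.
  apply: (@convex_hull_cvg _ _ _ A (fun=> x) (A 0%N)) => //.
  - by near=> n; exact: decr.
  - by near=> n; exact: Ax.
  - exact: cvg_cst.
apply: sub_smallest2r; first exact: convex_hull_convex.
move=> y Ay n _; apply: Ay; split => //.
by exists n => // m /=; exact: decr.
Unshelve. all: by end_near. Qed.

Lemma nested_compact_sub_open (A : nat -> set E) O :
  compact (A 0%N) -> (forall n, closed (A n)) ->
  (forall m n, (m <= n)%N -> A n `<=` A m) ->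
  open O -> \bigcap_n A n `<=` O -> exists n, A n `<=` O.
Proof.
move=> cA clA decr oO AO; apply: contrapT => /forallNP nAO.
have /choice[x xP] n : exists x, A n x /\ ~ O x.
  apply: contrapT => /forallNP nx; apply: (nAO n) => x Anx.
  by apply: contrapT => nOx; apply: (nx x).
have [U [UU FU]] := ultraFilterLemma eventually_filter.
have [|p _ xp] := ultra_compact_cvg (g := x) UU cA.
  by apply: FU; near=> n; apply: (decr 0%N n) => //; have [] := xP n.
have /AO Op : (\bigcap_n A n) p.
  move=> n _; apply: (@closed_cvg _ _ U _ x (A n) (clA n) _ _ xp); apply: FU.
  by exists n => // m /= nm; apply: (decr n m nm); have [] := xP m.
have : \forall n \near U, O (x n) by apply: xp; exact: open_nbhs_nbhs.
by move=> /filter_ex[n]; have [] := xP n.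
Unshelve. all: by end_near. Qed.

End Compactness.

(** * Separation by Euclidean balls *)

Section Separation.
Set Implicit Arguments.
Unset Strict Implicit.
Variables (R : realType) (d : nat).
Local Notation E := 'rV[R]_d.
Implicit Types (A B C K L : set E) (c x y z : E).

Definition sqdist x y : R := \sum_i (y ord0 i - x ord0 i) ^+ 2.

Lemma sqdistxx x : sqdist x x = 0.
Proof. by rewrite /sqdist big1// => i _; rewrite subrr expr0n. Qed.

Lemma sqdistC x y : sqdist x y = sqdist y x.
Proof. by apply: eq_bigr => i _; rewrite -sqrrN opprB. Qed.

Lemma sqdist_gt0 x y : x != y -> 0 < sqdist x y.
Proof.
move=> xy; rewrite lt_neqAle sumr_ge0 ?andbT => [|i _]; last exact: sqr_ge0.
apply: contra_neq xy => /esym s0; apply/rowP => i.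
have /eqP := psumr_eq0P (P := xpredT) (fun i _ => sqr_ge0 _) s0 (i := i) isT.
by rewrite sqrf_eq0 subr_eq0 => /eqP.
Qed.

Lemma sqdist_ge0 x y : 0 <= sqdist x y.
Proof. by apply: sumr_ge0 => i _; exact: sqr_ge0. Qed.

(** Stewart's identity; its last term expresses the strict convexity of balls,
and it replaces all uses of an inner product below. *)
Lemma sqdist_conv c x y (t : R) :
  sqdist c (t *: x + (1 - t) *: y) =
  t * sqdist c x + (1 - t) * sqdist c y - t * (1 - t) * sqdist x y.
Proof.
rewrite /sqdist !mulr_sumr -big_split/= -sumrB; apply: eq_bigr => i _.
rewrite !mxE; ring.
Qed.

Lemma sqdist_continuous c : continuous (sqdist c).
Proof.
apply: continuous_big => [|i _]; first exact: add_continuous.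
move=> y; apply: (@continuous_comp _ _ _
  (fun y : E => y ord0 i - c ord0 i) (fun u : R => u ^+ 2)).
  apply: (@cvgB _ _ _ _ _ (fun y : E => y ord0 i) (fun=> c ord0 i)).
  - exact: nbhs_filter.
  - exact: (@coord_continuous R 1 d ord0 i y).
  - by apply: cvg_cst; exact: nbhs_filter.
exact: exprn_continuous.
Qed.

Lemma sqdist_max A c : A !=set0 -> compact A ->
  exists2 z, A z & forall y, A y -> sqdist c y <= sqdist c z.
Proof.
move=> A0 cA.
have [|z /set_mem Az zmax] := EVT_max_rV (f := sqdist c) A0 cA.
  by apply: continuous_subspaceT; exact: sqdist_continuous.
by exists z => // y Ay; apply: zmax; exact: mem_set.
Qed.

Lemma sqdist_min A c : A !=set0 -> compact A ->
  exists2 z, A z & forall y, A y -> sqdist c z <= sqdist c y.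
Proof.
move=> A0 cA.
have [|z /set_mem Az zmin] := EVT_min_rV (f := sqdist c) A0 cA.
  by apply: continuous_subspaceT; exact: sqdist_continuous.
by exists z => // y Ay; apply: zmin; exact: mem_set.
Qed.

(** Let p be the point of C closest to x, and S > 0 the squared distance from x
to p.  The centre c lies on the line through x and p, far beyond p: then the
ball around c whose boundary passes through x looks near C like a half-space
bounded by the hyperplane at x orthogonal to p - x, and contains C. *)
Lemma ball_separation C x : compact C -> @convex_set R E C -> ~ C x ->
  exists c, forall y, C y -> sqdist c y < sqdist c x.
Proof.
move=> cC /convex_setE cvC nCx.
have [C0|nC0] := pselect (C !=set0); last first.
  by exists 0 => y Cy; case: nC0; exists y.
have [p Cp pmin] := sqdist_min x C0 cC.
have [q Cq qmax] := sqdist_max p C0 cC.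
set D := sqdist p q; pose S := sqdist x p.
have S0 : 0 < S by apply: sqdist_gt0; apply: contra_not_neq nCx => ->.
have D0 : 0 <= D by exact: sqdist_ge0.
(* With p = a c + (1 - a) x, the estimates below give a positive multiple of
   S - a |y - p|^2 as lower bound of |x - c|^2 - |y - c|^2 for y in C; a is
   chosen so that a D < S, where D bounds |y - p|^2. *)
pose a := S / (S + D + 1).
have SD0 : 0 < S + D + 1 by lra.
have a0 : 0 < a by exact: divr_gt0.
have aE : a * (S + D + 1) = S by rewrite /a divfK// gt_eqF.
have a1 : a < 1 by rewrite ltr_pdivrMr//; lra.
pose c := a^-1 *: p + (1 - a^-1) *: x; exists c => y Cy.
have yD : sqdist y p <= D by rewrite sqdistC; exact: qmax.
(* Minimality of p, tested at the point a y + (1 - a) p of C. *)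
have proj : S <= a * sqdist x y + (1 - a) * S - a * (1 - a) * sqdist y p.
  by rewrite -sqdist_conv; apply/pmin/cvC => //; lra.
have pE : p = a *: c + (1 - a) *: x.
  rewrite /c scalerDr !scalerA mulfV ?gt_eqF// scale1r -addrA -scalerDl.
  rewrite mulrBr mulr1 mulfV ?gt_eqF//.
  by rewrite addrC addrA subrK subrr scale0r add0r.
have yp : sqdist y p = a * sqdist y c + (1 - a) * sqdist y x
    - a * (1 - a) * sqdist c x.
  by rewrite {1}pE sqdist_conv.
have xp : S = a * sqdist x c - a * (1 - a) * sqdist c x.
  by rewrite /S {1}pE sqdist_conv sqdistxx mulr0 addr0.
rewrite (sqdistC y c) (sqdistC y x) in yp; rewrite (sqdistC x c) in xp.
have {}yD : a * sqdist y p < S by nra.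
have {}proj : S + (1 - a) * sqdist y p <= sqdist x y.
  by rewrite -(ler_pM2l a0); lra.
have a1_ge0 : 0 <= 1 - a by lra.
have a2_gt0 : 0 < 2 - a by lra.
have := ler_wpM2l a1_ge0 proj.
move: yD; rewrite -(ltr_pM2l a2_gt0) => yD proj'.
by rewrite -(ltr_pM2l a0); lra.
Qed.

(** The closed ball around c through z, deprived of its boundary point z, is
still convex: balls are strictly convex. *)
Lemma farthest_notin_convex_hull A c z :
  (forall y, A y -> sqdist c y <= sqdist c z) -> ~ A z -> ~ convex_hull A z.
Proof.
move=> zmax nAz; pose B := [set y | sqdist c y <= sqdist c z /\ y != z].
suff cB : @convex_set R E B.
  have /(_ z) hB : convex_hull A `<=` B.
    apply: smallest_sub => // y Ay; split; first exact: zmax.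
    by apply: contra_not_neq nAz => <-.
  by move=> /hB[_ /eqP].
apply/convex_setE => x y t t01 [xz xNz] [yz yNz].
have [->|t_neq0] := eqVneq t 0; first by rewrite scale0r add0r subr0 scale1r.
have [->|t_neq1] := eqVneq t 1; first by rewrite subrr scale0r addr0 scale1r.
have t0 : 0 < t by rewrite lt_neqAle eq_sym t_neq0; case/andP: t01.
have t1 : t < 1 by rewrite lt_neqAle t_neq1; case/andP: t01.
have t1t : 0 < t * (1 - t) by rewrite mulr_gt0// subr_gt0.
have t0x := ler_wpM2l (ltW t0) xz.
have t1y : (1 - t) * sqdist c y <= (1 - t) * sqdist c z.
  by rewrite ler_wpM2l// subr_ge0 ltW.
split.
  by have := mulr_ge0 (ltW t1t) (sqdist_ge0 x y); rewrite sqdist_conv; lra.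
have [xy|/sqdist_gt0 xy] := eqVneq x y.
  by rewrite xy -scalerDl addrC subrK scale1r.
apply/eqP => zE; have := sqdist_conv c x y t; rewrite zE.
by have := mulr_gt0 t1t xy; lra.
Qed.

End Separation.

(** * Iterates of the relaxation and their limit *)

Section Iteration.
Set Implicit Arguments.
Unset Strict Implicit.
Variables (R : realType) (d : nat).
Local Notation E := 'rV[R]_d.
Implicit Types (A B C K L : set E) (LL : set (set E)).

Lemma closed_setD_interior K L : closed K -> closed (K `\` interior L).
Proof.
by move=> cK; apply: closedI => //; apply: open_closedC; exact: open_interior.
Qed.

Lemma Rclass_convex LL K : @convex_set R E (Rclass LL K).
Proof.
apply/convex_setE => x y t t01 Rx Ry L LLL.
have /convex_setE := @convex_hull_convex R d (K `\` interior L).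
by apply => //; [exact: Rx|exact: Ry].
Qed.

Lemma Rclass_sub LL K : LL !=set0 -> @convex_set R E K -> Rclass LL K `<=` K.
Proof.
by move=> [L LLL] cK x /(_ L LLL); apply: smallest_sub => // y [].
Qed.

Lemma Rclass_closed LL K : compact K -> closed (Rclass LL K).
Proof.
move=> cK; apply: closed_bigI => L _; apply: convex_hull_closed.
have clK : closed K by exact: compact_closed_rV.
apply: (subclosed_compact _ cK); first exact: closed_setD_interior.
by move=> x [].
Qed.

Lemma setD_bigcup_interior_sub_Rclass LL K A :
  A `<=` ~` (\bigcup_(L in LL) interior L) -> A `<=` K -> A `<=` Rclass LL K.
Proof.
move=> AM AK x Ax L LLL; apply: sub_convex_hull; split; first exact: AK.
by move=> Lx; apply: (AM x Ax); exists L.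
Qed.

Variables (LL : set (set E)) (K : set E).
Hypotheses (LL0 : LL !=set0) (cK : compact K) (convK : @convex_set R E K).
Let M := ~` (\bigcup_(L in LL) interior L).
Let Ki i := iter i (Rclass LL) K.

Let Ki_compact_convex i : compact (Ki i) /\ @convex_set R E (Ki i).
Proof.
elim: i => // i [ci convi]; split; last exact: Rclass_convex.
apply: (subclosed_compact _ ci); first exact: Rclass_closed.
exact: Rclass_sub.
Qed.

Let Ki_closed i : closed (Ki i).
Proof.
by apply: compact_closed_rV; case: (Ki_compact_convex i).
Qed.

Let Ki_decr m n : (m <= n)%N -> Ki n `<=` Ki m.
Proof.
move=> /subnK <-; elim: (n - m)%N => // k IHk.
apply: subset_trans IHk; rewrite addSn; apply: Rclass_sub => //.
by case: (Ki_compact_convex (k + m)).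
Qed.

Lemma convex_hull_sub_iter i : convex_hull (K `&` M) `<=` Ki i.
Proof.
apply: smallest_sub; first by case: (Ki_compact_convex i).
elim: i => [x []//|i IHi] /=.
by apply: setD_bigcup_interior_sub_Rclass => // x [].
Qed.

(** The heart of the proof: the point z of the intersection farthest from the
centre of a separating ball cannot lie in M, and cannot lie in an interior
either. *)
Lemma bigcap_iter_sub_convex_hull : \bigcap_i Ki i `<=` convex_hull (K `&` M).
Proof.
move=> x Kx; apply: contrapT => nCx.
have cKi0 : compact (Ki 0%N) by [].
have cKM : compact (K `&` M).
  apply: (subclosed_compact _ cK) => [|y []//].
  apply: closedI; first exact: compact_closed_rV.
  by apply: open_closedC; apply: bigcup_open => L _; exact: open_interior.
have cC : compact (convex_hull (K `&` M)).
  apply: (subclosed_compact _ cK); first exact: convex_hull_closed.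
  exact: (@convex_hull_sub_iter 0%N).
have [c cP] := ball_separation cC (@convex_hull_convex _ _ _) nCx.
have [|z Kz zmax] := @sqdist_max R d (\bigcap_i Ki i) c (ex_intro _ x Kx).
  apply: (subclosed_compact _ cK); first exact: closed_bigI.
  by move=> y /(_ 0%N); exact.
have nMz : ~ M z.
  move=> Mz; have /cP : convex_hull (K `&` M) z.
    by apply: sub_convex_hull; split => //; exact: (Kz 0%N).
  by rewrite ltNge zmax.
have [L LLL Lz] : (\bigcup_(L in LL) interior L) z by exact: contrapT.
have : convex_hull (\bigcap_i (Ki i `\` interior L)) z.
  apply: bigcap_convex_hull.
  - apply: (subclosed_compact _ cK) => [|y []//].
    by apply: closed_setD_interior; apply: compact_closed_rV.
  - by move=> n; exact: closed_setD_interior.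
  - by move=> m n mn y [Ky nLy]; split => //; exact: Ki_decr Ky.
  (* z lies in K_{i+1}, hence in the relaxation of K_i by L. *)
  - by move=> i _; have := Kz i.+1 I; exact.
apply: (@farthest_notin_convex_hull _ _ _ c); last by move=> /(_ 0%N I)[].
by move=> y Ky; apply: zmax => i /Ky[].
Qed.

Lemma iter_Rclass_near_convex_hull (e : R) : 0 < e -> \forall n \near \oo,
  Ki n `<=` minkowski_sum (convex_hull (K `&` M)) (euclidean_ball (d := d) e).
Proof.
move=> e0.
pose O := \bigcup_(c in convex_hull (K `&` M)) [set x | sqdist c x < e ^+ 2].
have [| |N NO] := @nested_compact_sub_open R d Ki O cK Ki_closed Ki_decr.
- apply: bigcup_open => c _.
  apply: (@open_comp _ _ (sqdist c) [set r | r < e ^+ 2]); last exact: open_lt.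
  by move=> x _; exact: sqdist_continuous.
- move=> x /bigcap_iter_sub_convex_hull Cx; exists x => //=.
  by rewrite sqdistxx exprn_gt0.
exists N => // n /= Nn x /(Ki_decr Nn)/NO[c Cc /= cx].
exists c => //; exists (x - c); last by rewrite addrC subrK.
rewrite /euclidean_ball /euclidean_norm /=.
rewrite -[leRHS](ger0_norm (ltW e0)) -sqrtr_sqr.
rewrite ler_wsqrtr// (le_trans _ (ltW cx))//.
by apply: ler_sum => i _; rewrite !mxE.
Qed.

End Iteration.

Theorem corollary3p7 (R : realType) (d : nat) (d_gt0 : (0 < d)%N)
    (LL : set (set 'rV[R]_d)) (K : set 'rV[R]_d) :
  LL !=set0 ->
  (forall L, LL L ->
    [/\ closed L, @convex_set R 'rV[R]_d L & has_affine_dim L d]) ->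
  (forall L, LL L -> is_linear_space (recession_cone L)) ->
  closed K -> @convex_set R 'rV[R]_d K -> bounded_set K ->
  let M : set 'rV[R]_d := ~` (\bigcup_(L in LL) interior L) in
  (fun i : nat =>
     hausdorff_distance (iter i (Rclass LL) K) (convex_hull (K `&` M)))
    @ \oo --> (0%E : \bar R).
Proof.
move=> LL0 _ _ clK convK bK M.
have cK : compact K by exact: bounded_closed_compact.
set h := (h in h @ \oo --> _).
have h_ge0 n : (0 <= h n)%E.
  by apply: le_ereal_inf_tmp => _ [r [r0 _ _] <-]; rewrite lee_fin.
have h_le e : 0 < e -> \forall n \near \oo, (h n <= e%:E)%E.
  move=> e0; near=> n; apply: ereal_inf_lbound; exists e => //; split.
  - exact: ltW.
  - by near: n; exact: iter_Rclass_near_convex_hull.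
  - move=> x Cx; exists x; first exact: convex_hull_sub_iter.
    exists 0; last by rewrite addr0.
    rewrite /euclidean_ball /euclidean_norm /= big1 ?sqrtr0 ?ltW// => i _.
    by rewrite mxE expr0n.
apply/fine_cvgP; split.
  near=> n; rewrite ge0_fin_numE//.
  apply: le_lt_trans (ltry 1); near: n; exact: h_le.
apply/cvgrPdist_le => e e0; near=> n.
have hn : (h n <= e%:E)%E by near: n; exact: h_le.
rewrite sub0r normrN ger0_norm ?fine_ge0//.
by rewrite -lee_fin fineK// ge0_fin_numE// (le_lt_trans hn)// ltry.
Unshelve. all: by end_near. Qed.
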